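(* Let $\mathcal F$ be a finite L-nilpotent family of algebraic operators on a complex vector space $V$, and let $\mathcal A$ be the algebra generated by $\mathcal F$. Then there exists a finite direct decomposition $V=V_1\oplus\cdots\oplus V_m$ with respect to which every member of $\mathcal A$ has an upper triangular block form having scalar operators for diagonal blocks; that is, writing $P_i$ for the projection of $V$ onto $V_i$ along $\bigoplus_{j\neq i}V_j$, for every $T\in\mathcal A$ one has $P_iT|_{V_j}=0$ whenever $i>j$, and for each $i$ the operator $P_iT|_{V_i}:V_i\to V_i$ is a scalar multiple of the identity operator on $V_i$.
   Context: An operator on a complex vector space $V$ is a linear transformation $V\to V$. It is algebraic if $p(T)=0$ for some nonzero complex polynomial $p$. Write $[A,B]=AB-BA$. For a family $\mathcal F$ of operators put $\mathcal F^{[0]}=\mathcal F$ and $\mathcal F^{[k]}=\{[A,B] : A\in \mathcal F^{[k-1]},\ B\in\mathcal F\}$ for $k=1,2,\ldots$. The family $\mathcal F$ is L-nilpotent if $\mathcal F^{[k]}=\{0\}$ for some $k\in\mathbb N$. The algebra generated by $\mathcal F$ is the smallest associative algebra of operators on $V$ containing $\mathcal F$. *)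

(* Defs.v *)
From mathcomp Require Import all_boot all_order all_algebra.
From mathcomp Require Import boolp classical_sets functions cardinality reals.
From mathcomp Require Import complex.

Set Implicit Arguments.
Unset Strict Implicit.
Unset Printing Implicit Defensive.

Import GRing.Theory.

Local Open Scope ring_scope.
Local Open Scope classical_set_scope.

Section Operators.
Variables (K : fieldType) (V : lmodType K).

Notation operator := {linear V -> V}.

(* [{linear V -> V}] has no ring structure for a general [V] (and the zero ring
   would be excluded from algebra types), so [p(T)] is spelled out. *)
Definition poly_op (p : {poly K}) (T : operator) (v : V) : V :=
  \sum_(i < size p) p`_i *: iter i T v.

Definition algebraic_op (T : operator) : Prop :=
  exists2 p : {poly K}, p != 0 & forall v, poly_op p T v = 0.

Definition commutator (A B : operator) : operator := (A \o B) \- (B \o A).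

Fixpoint iter_commutators (F : set operator) (k : nat) : set operator :=
  if k is k'.+1 then
    [set commutator A B | A in iter_commutators F k' & B in F]
  else F.

Definition L_nilpotent (F : set operator) : Prop :=
  exists k : nat, iter_commutators F k = [set (\0 : operator)].

(* Algebras of operators are not required to contain the identity. *)
Definition operator_algebra (S : set operator) : Prop :=
  [/\ S (\0 : operator),
      forall A B, S A -> S B -> S (A \+ B : operator),
      forall (c : K) A, S A -> S (c \*: A : operator)
    & forall A B, S A -> S B -> S (A \o B : operator)].

Definition generated_algebra (F : set operator) : set operator :=
  smallest operator_algebra F.

Definition direct_decomposition (m : nat) (W : 'I_m -> {pred V}) : Prop :=
  (forall i, submod_closed (W i)) /\
  forall v : V, exists! x : 'I_m -> V,
    (forall i, x i \in W i) /\ v = \sum_i x i.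

Definition sum_of_others (m : nat) (W : 'I_m -> {pred V}) (i : 'I_m) : set V :=
  [set v | exists2 x : 'I_m -> V,
    forall j, j != i -> x j \in W j & v = \sum_(j | j != i) x j].

(* When [W] is a direct decomposition, these two conditions determine [P]. *)
Definition projection_along (m : nat) (W : 'I_m -> {pred V}) (i : 'I_m)
    (P : operator) : Prop :=
  (forall v, v \in W i -> P v = v) /\
  (forall v, sum_of_others W i v -> P v = 0).

Definition block_upper_triangular (m : nat) (W : 'I_m -> {pred V})
    (P : 'I_m -> operator) (T : operator) : Prop :=
  forall i j : 'I_m, (j < i)%N -> forall v, v \in W j -> P i (T v) = 0.

Definition scalar_diagonal_blocks (m : nat) (W : 'I_m -> {pred V})
    (P : 'I_m -> operator) (T : operator) : Prop :=
  forall i : 'I_m, exists c : K, forall v, v \in W i -> P i (T v) = c *: v.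

End Operators.

(* Main.v *)
Require Import Defs.
From HB Require Import structures.
From mathcomp Require Import all_boot all_order all_algebra.
From mathcomp Require Import boolp classical_sets functions cardinality reals.
From mathcomp Require Import complex.

(** It suffices to find a finite flag [0 = f 0 <= ... <= f n = V] of subspaces
    such that every [T] in [F] acts as a scalar on each quotient
    [f i.+1 / f i].  Operators with this property form an algebra, so all of the
    generated algebra has it, and taking for [W i] a complement of [f i] in
    [f i.+1] turns it into the block triangular form
    ([flag_decomposition]; complements exist by Zorn's lemma).

    The flag is built between two invariant subspaces [U <= X] by induction on
    the [k] for which the iterated commutators of length [k] map [X] into [U]
    ([flag_of_L_nilpotent]).  For [k = 0], [F] itself acts as [0] on [X / U].
    For the step, the commutators of length [k] commute with [F] modulo [U], so
    the image of such a [c], or of [c - l], added to [U] is again invariant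
    ([adjoin_imageP]).  Such images refine the pair [U <= X]:

    - if [k = 0], then [c] is algebraic, and splitting off the roots of an
      annihilating polynomial one at a time gives a finite chain with [c] scalar
      on its quotients ([chain_algebraic]).  Once this is done for each of the
      finitely many members of [F], the flag is complete;

    - if [k > 0], then [c = [b, a]] with [a] in [F] algebraic.  Since [c]
      commutes with [a] modulo [U], [b] acts on polynomials in [a] as the
      derivation [[b, p(a)] = p'(a) c].  Hence [p(a) = 0] on [X / U] forces
      [p'(a) = 0] on the image of [c]; repeating this, the derivatives of [p]
      end in a nonzero constant (characteristic [0]), so [c] is nilpotent on
      [X / U] and the images of its powers form a finite chain on whose quotients
      [c] is zero ([chain_commutator]).  Once this is done for the finitely many
      [c] of length [k], they all vanish on every quotient of the refined chain,
      and the induction hypothesis applies to each of these quotients.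

    Quotient spaces never appear: a statement about [X / U] is a statement about
    vectors of [X] modulo [U]. *)

Set Implicit Arguments.
Unset Strict Implicit.
Unset Printing Implicit Defensive.

Import GRing.Theory Num.Theory.

Local Open Scope ring_scope.
Local Open Scope classical_set_scope.

Lemma finite_set_ind (T : Type) (P : set T -> Prop) :
  P set0 -> (forall A x, P A -> P (A `|` [set x])) ->
  forall A, finite_set A -> P A.
Proof.
elim/Pchoice: T => T in P *; move=> P0 PU A /finite_seqP[s ->].
elim/last_ind: s => [|s x IHs]; first by have -> : [set` [::]] = set0 :> set T by apply/seteqP; split.
have -> : [set` rcons s x] = [set` s] `|` [set x]; last exact: PU.
apply/seteqP; split=> y /=; rewrite mem_rcons inE.
  by case/orP => [/eqP|]; [right | left].
by case=> [->|->]; rewrite ?orbT ?eqxx.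
Qed.

(** * Complements, projections and block triangular form *)

Section Subspaces.
Variables (K : fieldType) (V : lmodType K).
Notation operator := {linear V -> V}.
Implicit Types (U X Y : set V) (F : set operator).

Definition subspace U := U 0 /\ forall (a : K) u v, U u -> U v -> U (a *: u + v).

Lemma subspaceD U u v : subspace U -> U u -> U v -> U (u + v).
Proof. by move=> [_ UP] Uu Uv; rewrite -[u]scale1r; apply: UP. Qed.

Lemma subspaceZ U (a : K) u : subspace U -> U u -> U (a *: u).
Proof. by move=> [U0 UP] Uu; rewrite -[_ *: _]addr0; apply: UP. Qed.

Lemma subspaceB U u v : subspace U -> U u -> U v -> U (u - v).
Proof.
by move=> sU Uu Uv; apply: subspaceD => //; rewrite -scaleN1r; apply: subspaceZ.
Qed.

Lemma subspace_zero : subspace [set 0].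
Proof. by split=> // a u v /= -> ->; rewrite scaler0 addr0. Qed.

Lemma subspace_full : subspace setT. Proof. by []. Qed.

(** Zorn's lemma for the subsets [C] that are closed under linear combinations
    and meet [U] only in [0]; a maximal one together with [U] spans [V]. *)
Lemma subspace_complement U : subspace U ->
  exists C, [/\ subspace C, forall v, C v -> U v -> v = 0
              & forall v, exists2 u, U u & C (v - u)].
Proof.
move=> sU.
pose P C := (forall (a : K) u v, C u -> C v -> C (a *: u + v)) /\
            (forall v, C v -> U v -> v = 0).
have [|C [[CP CU] maxC]] := @Zorn_bigcup V P.
  move=> G GP totG; split; last by move=> v [C GC Cv]; have [_] := GP _ GC; apply.
  move=> a u v [C GC Cu] [D GD Dv].
  have [CD|DC] := totG _ _ GC GD.
    by exists D => //; have [DP _] := GP _ GD; apply: DP => //; apply: CD.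
  by exists C => //; have [CP _] := GP _ GC; apply: CP => //; apply: DC.
(* The empty set is admissible (it is the union of the empty chain), so that
   a maximal [C] contains [0] has to be proved. *)
have C0 : C 0.
  apply: contrapT => nC0; apply: (maxC [set 0]); last first.
    by split=> [a u v /= -> ->|v ->//]; rewrite scaler0 addr0.
  split=> [v Cv|/(_ 0 erefl)//].
  by case: nC0; have := CP (-1) v v Cv Cv; rewrite scaleN1r addNr.
have sC : subspace C by [].
exists C; split=> // v; apply: contrapT => nv.
(* Otherwise adding the line through [v] would enlarge [C]. *)
pose D := [set w | exists2 a : K, True & exists2 c, C c & w = a *: v + c].
apply: (maxC D).
  split=> [c Cc|DC]; first by exists 0 => //; exists c; rewrite ?scale0r ?add0r.
  apply: nv; exists 0; first exact: sU.1.
  by rewrite subr0; apply: DC; exists 1 => //; exists 0; rewrite ?scale1r ?addr0.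
split=> [a _ _ [b _ [c Cc ->]] [b' _ [c' Cc' ->]]|_ [a _ [c Cc ->]] Uw].
  exists (a * b + b') => //; exists (a *: c + c'); first exact: CP.
  by rewrite scalerDr scalerDl scalerA addrACA.
have [a0|a0] := eqVneq a 0.
  by move: Uw; rewrite a0 scale0r add0r; apply: CU.
case: nv; exists (a^-1 *: (a *: v + c)); first exact: subspaceZ.
rewrite scalerDr scalerA mulVf // scale1r opprD addNKr -scalerN.
by apply: subspaceZ => //; rewrite -scaleN1r; apply: subspaceZ.
Qed.

Lemma subspace_projection U : subspace U ->
  exists pi : operator, (forall v, U (pi v)) /\ (forall v, U v -> pi v = v).
Proof.
move=> sU; have [C [sC CU CD]] := subspace_complement sU.
have /choice[f fP] : forall v, exists u, U u /\ C (v - u).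
  by move=> v; have [u] := CD v; exists u.
have f_uniq v u : U u -> C (v - u) -> f v = u.
  move=> Uu Cu; have [Uf Cf] := fP v; apply/eqP; rewrite -subr_eq0; apply/eqP.
  apply: CU; last exact: subspaceB.
  have -> : f v - u = (v - u) - (v - f v) by rewrite opprB addrCA addrAC subrr add0r.
  exact: subspaceB.
have f_lin : linear f.
  move=> a u v; have [Uu Cu] := fP u; have [Uv Cv] := fP v.
  apply: f_uniq; first exact: sU.2.
  by rewrite opprD addrACA -scalerBr; apply: sC.2.
pose pi : operator := HB.pack f (GRing.isLinear.Build _ _ _ _ f f_lin).
exists pi; split=> v; first by case: (fP v).
by move=> Uv; apply: f_uniq => //; rewrite subrr; apply: sC.1.
Qed.

(** Arbitrary projections [pi i] onto [f i] do not have nested kernels, but the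
    composites [pi i \o ... \o pi n.-1] do, and they still project onto [f i]. *)
Lemma compatible_projections n (f : nat -> set V) :
  (forall i, (i <= n)%N -> subspace (f i)) -> f n = setT ->
  (forall i, (i < n)%N -> f i `<=` f i.+1) ->
  exists r : nat -> operator, forall i, (i <= n)%N ->
    [/\ forall v, f i (r i v), forall v, f i v -> r i v = v &
        forall j v, (i <= j <= n)%N -> r i (r j v) = r i v].
Proof.
move=> sf fn fS.
have /choice[pi piP] : forall i, exists pi : operator, (i <= n)%N ->
    (forall v, f i (pi v)) /\ (forall v, f i v -> pi v = v).
  move=> i; have [le_in|_] := leqP i n; last by exists idfun.
  by have [pi piP] := subspace_projection (sf i le_in); exists pi.
(* Indexed by codimension in the flag: [q d] projects onto [f (n - d)]. *)
pose fix q d : operator := if d is d'.+1 then pi (n - d)%N \o q d' else idfun.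
have q_im d v : (d <= n)%N -> f (n - d)%N (q d v).
  case: d => [|d] le_dn /=; first by rewrite subn0 fn.
  exact: (piP _ (leq_subr _ _)).1.
have q_id d : (d <= n)%N -> forall v, f (n - d)%N v -> q d v = v.
  elim: d => [|d IHd] //= lt_dn v fv.
  rewrite IHd ?(ltnW lt_dn) //; first exact: (piP _ (leq_subr _ _)).2.
  by rewrite -(subnSK lt_dn); apply: fS => //; rewrite subnSK // leq_subr.
have q_absorb d e v : (e <= d)%N -> (d <= n)%N -> q d (q e v) = q d v.
  elim: d => [|d IHd]; first by rewrite leqn0 => /eqP->.
  rewrite leq_eqVlt => /predU1P[-> le_dn|lt_ed lt_dn].
    by rewrite q_id //; apply: q_im.
  by rewrite /= IHd // ltnW.
exists (fun i => q (n - i)%N) => i le_in; split=> [v|v|j v /andP[le_ij le_jn]].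
- by have := q_im (n - i)%N v (leq_subr _ _); rewrite subKn.
- by move=> fv; apply: q_id; [exact: leq_subr | rewrite subKn].
- by apply: q_absorb; rewrite ?leq_sub2l ?leq_subr.
Qed.

(** With compatible projections [r i] onto [f i], the block [W i] is the kernel of
    [r i] in [f i.+1] and the projection onto it is [r i.+1 - r i]; these
    differences telescope to the identity. *)
Lemma flag_decomposition n (f : nat -> set V) :
  (forall i, (i <= n)%N -> subspace (f i)) -> f 0%N = [set 0] -> f n = setT ->
  (forall i, (i < n)%N -> f i `<=` f i.+1) ->
  exists (W : 'I_n -> {pred V}) (P : 'I_n -> operator),
    [/\ direct_decomposition W,
        forall i, projection_along W i (P i)
      & forall T : operator,
          (forall i, (i < n)%N -> exists c, forall v, f i.+1 v -> f i (T v - c *: v)) ->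
          block_upper_triangular W P T /\ scalar_diagonal_blocks W P T].
Proof.
move=> sf f0 fn fS.
have f_le i j : (i <= j <= n)%N -> f i `<=` f j.
  elim: j => [|j IHj] /andP[]; first by rewrite leqn0 => /eqP-> _; exact: subset_refl.
  rewrite leq_eqVlt => /predU1P[-> _|le_ij lt_jn]; first exact: subset_refl.
  apply: subset_trans (fS _ lt_jn); apply: IHj.
  by rewrite -ltnS le_ij ltnW.
have [r rP] := compatible_projections sf fn fS.
pose W (i : 'I_n) : {pred V} := fun v => `[< f i.+1 v /\ r i v = 0 >].
pose P (i : 'I_n) : operator := r i.+1 \- r i.
have WP (i : 'I_n) (v : V) : v \in W i <-> f i.+1 v /\ r i v = 0.
  by split=> /asboolP.
have f_P0 (i : 'I_n) v : f i v -> P i v = 0.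
  move=> fv; have [_ r1 _] := rP i (ltnW (ltn_ord i)).
  have [_ r2 _] := rP i.+1 (ltn_ord i).
  by rewrite /= r1 // r2 ?subrr //; apply: fS.
have P_W i v : P i v \in W i.
  apply/WP => /=; have [im1 id1 ab1] := rP i (ltnW (ltn_ord i)).
  have [im2 _ _] := rP i.+1 (ltn_ord i).
  split; last first.
    by rewrite linearB /= (ab1 i.+1) ?leqnSn ?ltn_ord // (id1 (r i v)) ?subrr.
  by apply: subspaceB => //; [exact: sf|apply: fS].
have P_id i v : v \in W i -> P i v = v.
  case/WP => fv rv0; have [_ id2 _] := rP i.+1 (ltn_ord i).
  by rewrite /= rv0 subr0 id2.
have P_other i j v : j != i -> v \in W j -> P i v = 0.
  move=> neq_ji /WP[fv rv0].
  have [lt_ij|lt_ji|eq_ij] := ltngtP i j; last by rewrite (ord_inj eq_ij) eqxx in neq_ji.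
    have r_kill k : (k <= j)%N -> r k v = 0.
      move=> le_kj; have le_jn := ltnW (ltn_ord j).
      have [_ _ abk] := rP k (leq_trans le_kj le_jn).
      by rewrite -(abk j) ?rv0 ?linear0 // le_kj.
    by rewrite /= !r_kill ?subrr // ltnW.
  by apply: f_P0; apply: f_le fv; rewrite lt_ji ltnW.
have sum_P v : v = \sum_i P i v.
  rewrite -(big_mkord xpredT (fun i => r i.+1 v - r i v)) telescope_sumr //.
  have [im0 _ _] := rP 0%N (leq0n n); have [_ idn _] := rP n (leqnn n).
  by have := im0 v; rewrite f0 /= => ->; rewrite subr0 idn // fn.
have P_sum i (x : 'I_n -> V) : (forall j, x j \in W j) -> P i (\sum_j x j) = x i.
  move=> xW; rewrite linear_sum (bigD1 i) //= big1 ?addr0; first exact: (P_id i).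
  by move=> j neq_ji; apply: (P_other i j).
exists W, P; split.
- split=> [i|v].
    have [s0 sZ] := sf i.+1 (ltn_ord i).
    split; first by apply/WP; rewrite linear0.
    move=> a u v /WP[fu ru] /WP[fv rv]; apply/WP; split; first exact: sZ.
    by rewrite linearP ru rv scaler0 addr0.
  exists (fun i => P i v); split; first by split.
  by move=> x [xW ->]; apply: funext => i; rewrite P_sum.
- move=> i; split; first exact: P_id.
  move=> _ [x xW ->]; rewrite linear_sum big1 // => j neq_ji.
  exact: P_other (xW j neq_ji).
- move=> T T_scalar; split=> [i j lt_ji v /WP[fv _]|i].
    have [c Tc] := T_scalar j (ltn_ord j); apply: f_P0.
    have fj : f j.+1 (T v).
      have sj := sf j.+1 (ltn_ord j).
      rewrite -[T v](subrK (c *: v)); apply: subspaceD => //.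
        by apply: fS => //; apply: Tc.
      exact: subspaceZ.
    by apply: f_le fj; rewrite lt_ji ltnW.
  have [c Tc] := T_scalar i (ltn_ord i); exists c => v Wv.
  have [fv _] := (WP _ _).1 Wv; apply/eqP; rewrite -subr_eq0.
  by rewrite -{2}(P_id _ _ Wv) -linearZ -linearB f_P0 //; apply: Tc.
Qed.

End Subspaces.

(** * Invariant subspaces and operators commuting with a family modulo a subspace *)

Section Invariance.
Variables (K : fieldType) (V : lmodType K).
Notation operator := {linear V -> V}.
Implicit Types (U X Y Z : set V) (F C : set operator) (a b c T : operator).

Definition invariant F U := subspace U /\ forall T, F T -> forall v, U v -> U (T v).

Lemma invariant_commutators F U k c :
  invariant F U -> iter_commutators F k c -> forall v, U v -> U (c v).
Proof.
move=> [sU FU]; elim: k c => [|k IHk] c /=; first exact: FU.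
move=> [b Fb [a Fa <-]] v Uv /=.
apply: subspaceB => //; first by apply: (IHk b) => //; apply: FU.
by apply: FU => //; apply: (IHk b).
Qed.

(** [c] commutes with [F] as a map from [X] to [V / U]. *)
Definition central_on F U X c := forall T, F T -> forall v, X v -> U (commutator c T v).

Lemma central_on_sub F U X Y Z c :
  U `<=` Y -> Z `<=` X -> central_on F U X c -> central_on F Y Z c.
Proof. by move=> UY ZX cF T FT v /ZX Xv; apply/UY/cF. Qed.

Definition adjoin_image U X c : set V :=
  [set w | exists2 u, U u & exists2 x, X x & w = u + c x].

(** The image of [c] on [X / U] is [F]-invariant because [T c = c T - [c, T]] and
    the commutator maps [X] into [U]. *)
Lemma adjoin_imageP F U X c :
  invariant F U -> invariant F X -> U `<=` X -> (forall v, X v -> X (c v)) ->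
  central_on F U X c ->
  [/\ invariant F (adjoin_image U X c), U `<=` adjoin_image U X c,
      adjoin_image U X c `<=` X & forall v, X v -> adjoin_image U X c (c v)].
Proof.
move=> [sU FU] [sX FX] UX cX cF; have [U0 UP] := sU; have [X0 XP] := sX; split.
- split; first split.
  + by exists 0 => //; exists 0; rewrite // linear0 addr0.
  + move=> t _ _ [u Uu [x Xx ->]] [u' Uu' [x' Xx' ->]].
    exists (t *: u + u'); first exact: UP.
    exists (t *: x + x'); first exact: XP.
    by rewrite linearP scalerDr addrACA.
  + move=> T FT _ [u Uu [x Xx ->]]; exists (T u - (c (T x) - T (c x))).
      by apply: subspaceB => //; [exact: FU | exact: (cF T)].
    exists (T x); first exact: FX.
    by rewrite linearD opprB -addrA subrK.
- by move=> u Uu; exists u => //; exists 0; rewrite ?linear0 ?addr0.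
- by move=> _ [u Uu [x Xx ->]]; apply: subspaceD; [|apply: UX|apply: cX].
- by move=> v Xv; exists 0 => //; exists v; rewrite ?add0r.
Qed.

(** * Polynomials of an operator *)

Lemma poly_op_widen (p : {poly K}) T v n : (size p <= n)%N ->
  poly_op p T v = \sum_(i < n) p`_i *: iter i T v.
Proof.
move=> le_pn; rewrite /poly_op (big_ord_widen n (fun i => p`_i *: iter i T v)) //.
rewrite big_mkcond; apply: eq_bigr => i _; case: ltnP => // le_pi.
by rewrite nth_default // scale0r.
Qed.

Lemma poly_opDl (p q : {poly K}) T v :
  poly_op (p + q) T v = poly_op p T v + poly_op q T v.
Proof.
pose n := maxn (size p) (size q).
rewrite !(@poly_op_widen _ _ _ n) ?leq_maxl ?leq_maxr ?size_polyD //.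
by rewrite -big_split; apply: eq_bigr => i _; rewrite coefD scalerDl.
Qed.

Lemma poly_op_polyC (k : K) T v : poly_op k%:P T v = k *: v.
Proof.
by rewrite (@poly_op_widen _ _ _ 1) ?size_polyC_leq1 // big_ord1 coefC.
Qed.

Lemma poly_opMX (p : {poly K}) T v : poly_op (p * 'X) T v = poly_op p T (T v).
Proof.
rewrite (@poly_op_widen _ _ _ (size p).+1) ?size_polyMX_leq//; last first.
  by have [->|p0] := eqVneq p 0; rewrite ?mul0r ?size_poly0 // size_mulX.
rewrite big_ord_recl coefMX scale0r add0r; apply: eq_bigr => i _.
by rewrite coefMX /= -iterS iterSr.
Qed.

Lemma poly_op_linear (p : {poly K}) T (k : K) u v :
  poly_op p T (k *: u + v) = k *: poly_op p T u + poly_op p T v.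
Proof.
elim/poly_ind: p u v => [|p c IHp] u v.
  by rewrite !poly_op_polyC !scale0r scaler0 addr0.
rewrite !poly_opDl !poly_opMX !poly_op_polyC linearP IHp !scalerDr addrACA.
by rewrite !scalerA mulrC.
Qed.

Lemma poly_opB (p : {poly K}) T u v :
  poly_op p T (u - v) = poly_op p T u - poly_op p T v.
Proof. by rewrite addrC -scaleN1r poly_op_linear scaleN1r addrC. Qed.

Lemma poly_opZl (k : K) (p : {poly K}) T v :
  poly_op (k *: p) T v = k *: poly_op p T v.
Proof.
rewrite (@poly_op_widen _ _ _ (size p)) ?size_scale_leq // scaler_sumr.
by apply: eq_bigr => i _; rewrite coefZ scalerA.
Qed.

Lemma poly_op_factor (p : {poly K}) (l : K) T v :
  poly_op (p * ('X - l%:P)) T v = poly_op p T (T v - l *: v).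
Proof.
have -> : p * ('X - l%:P) = p * 'X + (- l) *: p.
  by rewrite mulrBr [p * l%:P]mulrC mul_polyC scaleNr.
by rewrite [T v - _]addrC -scaleNr poly_op_linear poly_opDl poly_opMX poly_opZl addrC.
Qed.


Lemma poly_op_invariant (p : {poly K}) T U : subspace U ->
  (forall v, U v -> U (T v)) -> forall v, U v -> U (poly_op p T v).
Proof.
move=> sU TU; elim/poly_ind: p => [|p c IHp] v Uv.
  by rewrite poly_op_polyC; apply: subspaceZ.
rewrite poly_opDl poly_opMX poly_op_polyC; apply: subspaceD => //.
  by apply/IHp/TU.
exact: subspaceZ.
Qed.

(** The identity [[b, p(a)] = p'(a) [b, a]] holds as soon as [a] commutes with
    [[b, a]]; here this is only assumed on [X] modulo [U]. *)
Lemma commutator_poly_op (p : {poly K}) a b U X : subspace U ->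
  (forall v, U v -> U (a v)) -> (forall v, X v -> X (a v)) ->
  (forall v, X v -> U (commutator (commutator b a) a v)) ->
  forall v, X v ->
    U (b (poly_op p a v) - poly_op p a (b v) - poly_op p^`() a (commutator b a v)).
Proof.
have cE v : commutator b a v = b (a v) - a (b v) by [].
move: (commutator b a) cE => c cE sU aU aX Uc.
elim/poly_ind: p => [|p k IHp] v Xv.
  rewrite deriv0 !poly_op_polyC !scale0r linear0 !subr0; exact: sU.1.
rewrite derivD derivC addr0 derivM derivX mulr1 !poly_opDl !poly_opMX !poly_op_polyC.
have -> : poly_op p a (c v) = poly_op p a (b (a v)) - poly_op p a (a (b v)).
  by rewrite -poly_opB cE.
have Ud : U (poly_op p^`() a (c (a v)) - poly_op p^`() a (a (c v))).
  by rewrite -poly_opB; apply: poly_op_invariant => //; apply: Uc.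
have := subspaceD sU Ud (IHp _ (aX _ Xv)); congr (U _).
rewrite linearD linearZ /= addrC subrKA.
rewrite [in X in _ = X - _]opprD.
rewrite [X in _ = X - _]addrACA subrr addr0.
rewrite [X in _ = _ - X]addrA opprB subrKA opprD [X in _ = _ + X]addrC.
by rewrite addrA.
Qed.

End Invariance.

(** * Chains of subspaces and their refinement *)

Section Flags.
Variables (K : fieldType) (V : lmodType K).
Notation operator := {linear V -> V}.
Implicit Types (U X Y Z : set V) (F C : set operator) (a b c T : operator).

Inductive chain (E : set V -> set V -> Prop) U : set V -> Prop :=
| chain_refl : chain E U U
| chain_step Y X : chain E U Y -> E Y X -> chain E U X.

Lemma chain_trans E U Y X : chain E U Y -> chain E Y X -> chain E U X.
Proof. by move=> UY; elim=> // Z W _ UZ ZW; apply: chain_step ZW. Qed.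

Lemma chain_one (E : set V -> set V -> Prop) U X : E U X -> chain E U X.
Proof. exact/chain_step/chain_refl. Qed.

Lemma chain_sub (E : set V -> set V -> Prop) U X :
  (forall Y Z, E Y Z -> Y `<=` Z) -> chain E U X -> U `<=` X.
Proof.
by move=> Esub; elim=> [|Y Z _ UY /Esub]; [exact: subset_refl | exact: subset_trans].
Qed.

Lemma chain_refine (E E' : set V -> set V -> Prop) U X :
  (forall Y Z, E Y Z -> Y `<=` Z) ->
  (forall Y Z, U `<=` Y -> Z `<=` X -> E Y Z -> chain E' Y Z) ->
  chain E U X -> chain E' U X.
Proof.
move=> Esub EE' UX; elim: UX EE' => [|Y Z UY IH YZ] EE'; first exact: chain_refl.
apply: chain_trans (EE' Y Z _ (@subset_refl _ _) YZ); last exact: chain_sub UY.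
by apply: IH => Y' Z' UY' ZY'; apply: EE' => //; apply: subset_trans ZY' (Esub _ _ YZ).
Qed.

Lemma chain_index E U X : chain E U X ->
  exists n (f : nat -> set V),
    [/\ f 0%N = U, f n = X & forall i, (i < n)%N -> E (f i) (f i.+1)].
Proof.
elim=> [|Y Z _ [n [f [f0 fn fE]]] YZ]; first by exists 0%N, (fun=> U).
exists n.+1, (fun i => if (i <= n)%N then f i else Z).
split=> [//||i]; first by rewrite ltnn.
rewrite ltnS => le_in; rewrite le_in; have [lt_in|le_ni] := ltnP i n; first exact: fE.
by have -> : i = n; [apply/eqP; rewrite eqn_leq le_in | rewrite fn].
Qed.

(** The set [S] of allowed scalars is all of [K] for members of the family, and
    [[set 0]] for commutators, which have to act as zero. *)
Definition scalar_step F C (S : set K) Y X :=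
  [/\ invariant F Y, invariant F X, Y `<=` X &
      forall c, C c -> exists2 k, S k & forall v, X v -> Y (c v - k *: v)].

Lemma scalar_step_sub F C S Y Z : scalar_step F C S Y Z -> Y `<=` Z.
Proof. by case. Qed.

(** Operators that commute with [F] modulo [U] can be treated one after another:
    they still do on every quotient of a refined chain, and refining a chain
    preserves the scalar action of those already treated. *)
Lemma chain_scalar_all F C S U X :
  finite_set C ->
  (forall c, C c -> forall Y Z, invariant F Y -> invariant F Z -> Y `<=` Z ->
     central_on F Y Z c -> chain (scalar_step F [set c] S) Y Z) ->
  invariant F U -> invariant F X -> U `<=` X ->
  (forall c, C c -> central_on F U X c) -> chain (scalar_step F C S) U X.
Proof.
move=> finC + iU iX UX; elim/finite_set_ind: finC => [_ _|C' c IH Cflag Ccentral].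
  by apply: chain_one; split.
have {}IH : chain (scalar_step F C' S) U X.
  by apply: IH => [b C'b|b C'b]; [apply: Cflag; left | apply: Ccentral; left].
apply: chain_refine IH; first exact: scalar_step_sub.
move=> Y Z UY ZX [iY iZ YZ C'YZ].
have c_chain : chain (scalar_step F [set c] S) Y Z.
  apply: Cflag => //; first by right.
  by apply: central_on_sub (Ccentral c _); [..|right].
apply: chain_refine c_chain; first exact: scalar_step_sub.
move=> Y' Z' YY' Z'Z [iY' iZ' Y'Z' cYZ']; apply: chain_one; split=> // b [C'b|->].
  have [k Sk kP] := C'YZ b C'b.
  by exists k => // v /Z'Z Zv; apply/YY'/kP.
exact: cYZ'.
Qed.

End Flags.

(** * Flags for L-nilpotent families of algebraic operators *)

Section AlgebraicFamilies.
Variables (K : numClosedFieldType) (V : lmodType K).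
Notation operator := {linear V -> V}.
Implicit Types (U X Y Z : set V) (F C : set operator) (a b c T : operator).

Lemma poly_op_const_sub (p : {poly K}) a U X : size p = 1%N -> subspace U ->
  (forall v, X v -> U (poly_op p a v)) -> X `<=` U.
Proof.
move/eqP/size_poly1P => [k k0 ->] sU pX v /pX; rewrite poly_op_polyC => Ukv.
by rewrite -[v]scale1r -(mulVf k0) -scalerA; apply: subspaceZ.
Qed.

(** If [p = q * ('X - l)] annihilates [a] on [X / U], then [q] annihilates it on
    the image of [a - l], modulo which [a] is the scalar [l]. *)
Lemma chain_algebraic F a (p : {poly K}) U X : F a -> p != 0 ->
  invariant F U -> invariant F X -> U `<=` X -> central_on F U X a ->
  (forall v, X v -> U (poly_op p a v)) ->
  chain (scalar_step F [set a] setT) U X.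
Proof.
move=> Fa; have [n] := ubnP (size p); elim: n p X => // n IHn p X lt_pn p0 iU iX UX aF pX.
have [size1|/closed_rootP[l /factor_theorem[q pE]]] := eqVneq (size p) 1%N.
  have -> : X = U.
    by apply/seteqP; split=> //; exact: (poly_op_const_sub size1 iU.1 pX).
  exact: chain_refl.
have q0 : q != 0 by apply: contraNneq p0 => q0; rewrite pE q0 mul0r.
pose g : operator := a \- (l \*: idfun).
have gX v : X v -> X (g v).
  have [sX FX] := iX.
  by move=> Xv; apply: subspaceB; [|exact: FX|exact: subspaceZ].
have gF : central_on F U X g.
  move=> T FT v Xv; have := aF T FT v Xv; congr (U _).
  by rewrite /= linearB opprB [T (l *: v)]linearZ /= subrKA.
have [iY UY YX gY] := adjoin_imageP iU iX UX gX gF.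
set Y := adjoin_image U X g in iY UY YX gY.
apply: (@chain_step _ _ _ _ Y); last first.
  by split=> // _ ->; exists l.
apply: (IHn q) => //.
- by move: lt_pn; rewrite pE size_Mmonic ?monicXsubC // size_XsubC addn2.
- by apply: central_on_sub aF.
- move=> _ [u Uu [x Xx ->]]; rewrite addrC -[u]opprK poly_opB.
  apply: subspaceB; first exact: iU.1.
    by rewrite /= -poly_op_factor -pE; apply: pX.
  apply: poly_op_invariant; [exact: iU.1|exact: iU.2|].
  by rewrite -scaleN1r; apply: subspaceZ => //; exact: iU.1.
Qed.

Lemma deriv_neq0 (p : {poly K}) : (1 < size p)%N -> p^`() != 0.
Proof.
move=> size_p; apply/eqP => /(congr1 (fun q : {poly K} => q`_(size p).-2))/eqP.
rewrite coef_deriv coef0 mulrn_eq0 /=.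
have -> : (size p).-2.+1 = (size p).-1 by case: (size p) size_p => [|[]].
by rewrite -/(lead_coef p) lead_coef_eq0 -size_poly_eq0; case: (size p) size_p.
Qed.

(** If [p(a)] vanishes on [X / U], then so does [p'(a) [b, a] = [b, p(a)]], that
    is, [p'(a)] vanishes on the image of [[b, a]].  The induction on the size of
    [p] ends with a nonzero constant, where the image is trivial. *)
Lemma chain_commutator F k a b (p : {poly K}) U X : F a -> iter_commutators F k b ->
  p != 0 ->
  invariant F U -> invariant F X -> U `<=` X -> central_on F U X (commutator b a) ->
  (forall v, X v -> U (poly_op p a v)) ->
  chain (scalar_step F [set commutator b a] [set 0]) U X.
Proof.
move=> Fa Fb; have Fc : iter_commutators F k.+1 (commutator b a) by exists b => //; exists a.
have [n] := ubnP (size p); elim: n p X => // n IHn p X lt_pn p0 iU iX UX cF pX.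
have [size1|size_n1] := eqVneq (size p) 1%N.
  have -> : X = U.
    by apply/seteqP; split=> //; exact: (poly_op_const_sub size1 iU.1 pX).
  exact: chain_refl.
have size_p : (1 < size p)%N by rewrite ltn_neqAle eq_sym size_n1 size_poly_gt0.
have cX := invariant_commutators iX Fc;
have [iY UY YX cY] := adjoin_imageP iU iX UX cX cF.
set Y := adjoin_image U X _ in iY UY YX cY.
have [sU FU] := iU; have aX := iX.2 a Fa; have bX := invariant_commutators iX Fb.
apply: (@chain_step _ _ _ _ Y); last first.
  by split=> // _ ->; exists 0 => // v Xv; rewrite scale0r subr0; apply: cY.
apply: (IHn p^`()) => //.
- exact: leq_trans (lt_size_deriv p0) lt_pn.
- exact: deriv_neq0.
- by apply: central_on_sub cF.
- move=> _ [u Uu [x Xx ->]]; rewrite -[u]scale1r poly_op_linear scale1r.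
  apply: subspaceD => //; first by apply: poly_op_invariant => //; apply: FU.
  have := commutator_poly_op p sU (FU a Fa) aX (cF a Fa) Xx.
  have Ud := subspaceB sU (invariant_commutators iU Fb (pX _ Xx)) (pX _ (bX _ Xx)).
  by move/(subspaceB sU Ud); rewrite subKr.
Qed.

(** The step from [k] to [k.+1] refines [U <= X] by the commutators of length [k].
    When these are the members of [F] themselves this is already a flag; otherwise
    they vanish on every quotient, where the induction hypothesis applies. *)
Lemma flag_of_L_nilpotent F U X k : finite_set F ->
  (forall T, F T -> algebraic_op T) ->
  invariant F U -> invariant F X -> U `<=` X ->
  (forall c, iter_commutators F k c -> forall v, X v -> U (c v)) ->
  chain (scalar_step F F setT) U X.
Proof.
move=> finF algF; have fin k' : finite_set (iter_commutators F k').
  by elim: k' => //= k' IHk; apply: finite_image2.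
elim: k U X => [|k IHk] U X iU iX UX cX.
  apply: chain_one; split=> // T FT; exists 0 => // v Xv.
  by rewrite scale0r subr0; apply: cX.
have central c : iter_commutators F k c -> central_on F U X c.
  by move=> Fc T FT v; apply: cX; exists c => //; exists T.
case: k => [|k] in IHk cX central.
  apply: chain_scalar_all => // a Fa Y Z iY iZ YZ aF; have [p p0 pa] := algF a Fa.
  by apply: (chain_algebraic Fa p0) => // v _; rewrite pa; exact: iY.1.1.
have killed : chain (scalar_step F (iter_commutators F k.+1) [set 0]) U X.
  apply: chain_scalar_all => // _ [b Fb [a Fa <-]] Y Z iY iZ YZ cF.
  have [p p0 pa] := algF a Fa.
  by apply: (chain_commutator Fa Fb p0) => // v _; rewrite pa; exact: iY.1.1.
apply: chain_refine killed; first exact: scalar_step_sub.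
move=> Y Z _ _ [iY iZ YZ cYZ]; apply: IHk => // c Fc v Zv.
by have [_ ->] := cYZ c Fc; move/(_ v Zv); rewrite scale0r subr0.
Qed.

Definition scalar_on_flag n (f : nat -> set V) : set operator :=
  [set T | forall i, (i < n)%N -> exists k : K, forall v, f i.+1 v -> f i (T v - k *: v)].

(** For products, [A B v - a b v = A w + b (A v - a v)] with [w = B v - b v], and
    [w] lies in [f i <= f i.+1], where [A] is again the scalar [a] modulo [f i]. *)
Lemma operator_algebra_scalar_on_flag n (f : nat -> set V) :
  (forall i, (i <= n)%N -> subspace (f i)) -> (forall i, (i < n)%N -> f i `<=` f i.+1) ->
  operator_algebra (scalar_on_flag n f).
Proof.
move=> sf fS; split.
- move=> i lt_in; exists 0 => v _; rewrite /= scale0r subrr.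
  by have [] := sf i (ltnW lt_in).
- move=> A B SA SB i lt_in; have [a Aa] := SA i lt_in; have [b Bb] := SB i lt_in.
  exists (a + b) => v fv; rewrite /= scalerDl opprD addrACA.
  by apply: subspaceD; [exact/sf/ltnW | exact: Aa | exact: Bb].
- move=> c A SA i lt_in; have [a Aa] := SA i lt_in; exists (c * a) => v fv.
  rewrite /= -scalerA -scalerBr.
  by apply: subspaceZ; [exact/sf/ltnW | exact: Aa].
- move=> A B SA SB i lt_in; have [a Aa] := SA i lt_in; have [b Bb] := SB i lt_in.
  have sfi := sf i (ltnW lt_in).
  exists (a * b) => v fv; have fw := Bb v fv; set w := B v - b *: v in fw.
  have -> : (A \o B) v - (a * b) *: v = (A w - a *: w) + a *: w + b *: (A v - a *: v).
    by rewrite subrK scalerBr scalerA [b * a]mulrC addrA /w linearB [A (b *: v)]linearZ subrK.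
  apply: subspaceD => //; last by apply: subspaceZ => //; apply: Aa.
  apply: subspaceD => //; last exact: subspaceZ.
  by apply: Aa; apply: fS.
Qed.

End AlgebraicFamilies.

Theorem theorem3p2 (R : realType) (V : lmodType R[i])
    (F : set {linear V -> V}) :
  finite_set F ->
  L_nilpotent F ->
  (forall T : {linear V -> V}, F T -> algebraic_op T) ->
  exists (m : nat) (W : 'I_m -> {pred V}) (P : 'I_m -> {linear V -> V}),
    [/\ direct_decomposition W,
        forall i : 'I_m, projection_along W i (P i)
      & forall T : {linear V -> V}, generated_algebra F T ->
          block_upper_triangular W P T /\ scalar_diagonal_blocks W P T].
Proof.
move=> finF [k Fk] algF.
have iV : invariant F setT by split=> //; exact: subspace_full.
have i0 : invariant F [set 0].
  by split=> [|T _ v /= ->]; [exact: subspace_zero | rewrite linear0].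
have killF c : iter_commutators F k c -> forall v, [set: V] v -> [set 0] (c v).
  by rewrite Fk => -> v _.
have := flag_of_L_nilpotent finF algF i0 iV (@subsetT _ _) killF.
move=> /chain_index[n [f [f0 fn fE]]].
have fS i : (i < n)%N -> f i `<=` f i.+1 by move/fE/scalar_step_sub.
have sf i : (i <= n)%N -> subspace (f i).
  rewrite leq_eqVlt => /predU1P[->|/fE[[]//]].
  by rewrite fn; exact: subspace_full.
have [W [P [decW projP triP]]] := flag_decomposition sf f0 fn fS.
exists n, W, P; split=> // T genT; apply: triP.
apply: (smallest_sub (operator_algebra_scalar_on_flag sf fS)) genT => A FA i lt_in.
by have [_ _ _ /(_ A FA)[c _ Ac]] := fE i lt_in; exists c.
Qed.
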